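(* For every $k \in \mathbb{N}$, there exists an effective constant $C_k > 0$ so that for every $n \in \mathbb{N}$ there exist integers $1 \le a_1, \ldots, a_k \le n$ so that $$0 < \left\| \sum_{j=1}^{k} \sqrt{a_j} \right\| \le C_k \cdot n^{-k/2}.$$
   Context: $\mathbb{N} = \{1,2,\ldots\}$ is the set of natural numbers. For a real number $x$, $\|x\| := \min_{m \in \mathbb{Z}} |x - m|$ denotes the distance from $x$ to the nearest integer. The constant $C_k$ depends only on $k$.
   Formalization: The claim is stated for n ≥ 2 instead of all n ≥ 1: for n = 1 the only choice is a_1 = … = a_k = 1, so the sum is the integer k and its distance to the nearest integer is 0, contradicting the strict inequality. *)

(* Defs.v *)
From HB Require Import structures.
From mathcomp Require Import all_boot all_order all_algebra.
From mathcomp Require Import all_classical all_reals all_analysis.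

Set Implicit Arguments.
Unset Strict Implicit.
Unset Printing Implicit Defensive.

Import Order.TTheory GRing.Theory Num.Theory.
Local Open Scope classical_set_scope.
Local Open Scope ring_scope.

Definition dist_int (R : realType) (x : R) : R :=
  inf [set `|x - m%:~R| | m in [set: int]].

(* The infimum is attained, so [dist_int] is the minimum over the integers. *)
Lemma dist_int_le (R : realType) (x : R) (m : int) :
  dist_int x <= `|x - m%:~R|.
Proof.
by apply: ge_inf; [exists 0 => _ [p _ <-] | exists m].
Qed.

Lemma dist_int_attained (R : realType) (x : R) :
  exists m : int, dist_int x = `|x - m%:~R|.
Proof.
pose d (m : int) := `|x - m%:~R|.
pose f := Num.floor x.
have fx : f%:~R <= x by exact: Num.Theory.floor_le.
have xf : x < f%:~R + 1.
  by have := floorD1_gt x; rewrite intrD.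
pose m0 := if d f <= d (f + 1) then f else f + 1.
have m0P m : d m0 <= d m.
  have [mf|fm] := leP m f.
    have : d f <= d m.
      rewrite /d !ger0_norm ?subr_ge0 ?lerB ?ler_int//.
      by rewrite (le_trans _ fx)// ler_int.
    by apply: le_trans; rewrite /m0; case: (leP (d f)) => // /ltW.
  have : d (f + 1) <= d m.
    have xf1 : x <= (f + 1)%:~R by rewrite intrD ltW.
    have f1m : (f + 1)%:~R <= m%:~R :> R by rewrite ler_int lezD1.
    rewrite /d ![`|x - _|]distrC !ger0_norm ?subr_ge0 ?lerB//.
    exact: le_trans f1m.
  by apply: le_trans; rewrite /m0; case: (leP (d f)).
exists m0; apply/eqP; rewrite eq_le dist_int_le /=.
by apply: lb_le_inf; [exists (d 0), 0 | move=> _ [p _ <-]; exact: m0P].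
Qed.

(* General recursive functions: [recursive_mu] minimizes only functions that
   have a zero for every parameter, so that only total functions occur.  Each
   rule specifies [h] pointwise, which makes the class extensional. *)
Inductive recursive : forall n : nat, (n.-tuple nat -> nat) -> Prop :=
| recursive_zero n (h : n.-tuple nat -> nat) :
    (forall v, h v = 0%N) -> recursive h
| recursive_succ (h : 1.-tuple nat -> nat) :
    (forall v, h v = (thead v).+1) -> recursive h
| recursive_proj n (i : 'I_n) (h : n.-tuple nat -> nat) :
    (forall v, h v = tnth v i) -> recursive h
| recursive_comp m n (f : m.-tuple nat -> nat)
      (g : 'I_m -> n.-tuple nat -> nat) (h : n.-tuple nat -> nat) :
    recursive f -> (forall i, recursive (g i)) ->
    (forall v, h v = f [tuple g i v | i < m]) -> recursive h
| recursive_prec n (f : n.-tuple nat -> nat) (g : n.+2.-tuple nat -> nat)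
      (h : n.+1.-tuple nat -> nat) :
    recursive f -> recursive g ->
    (forall v : n.-tuple nat, h [tuple of 0%N :: v] = f v) ->
    (forall (x : nat) (v : n.-tuple nat), h [tuple of x.+1 :: v] =
       g [tuple of x :: h [tuple of x :: v] :: v]) -> recursive h
| recursive_mu n (f : n.+1.-tuple nat -> nat) (h : n.-tuple nat -> nat) :
    recursive f ->
    (forall v : n.-tuple nat, f [tuple of h v :: v] = 0%N) ->
    (forall (v : n.-tuple nat) (x : nat),
       (x < h v)%N -> f [tuple of x :: v] <> 0%N) -> recursive h.

(* A computable sequence of reals: an algorithm takes k and m to a dyadic
   rational at distance at most 2^-m from C k (the difference p - q ranges
   over all integers). *)
Definition computable_sequence (R : realType) (C : nat -> R) : Prop :=
  exists p q : 2.-tuple nat -> nat,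
    [/\ recursive p, recursive q &
     forall k m : nat,
       `|C k - ((p [tuple k; m])%:R - (q [tuple k; m])%:R) / 2 ^+ m|
         <= 2 ^- m].

(* Main.v *)
Require Import Defs.
From mathcomp Require Import all_boot all_order perm all_algebra.
From mathcomp Require Import all_classical all_reals all_analysis.
From mathcomp Require Import ring lra zify.

Set Implicit Arguments.
Unset Strict Implicit.
Unset Printing Implicit Defensive.

Import Order.TTheory GRing.Theory Num.Theory.
Local Open Scope ring_scope.

(* As X grows, sqrt ((X + x)^2 + 4 s) = X + x + (2 s / X) V (-1/X), where V is
   the power series solving (1 - x t) V + s t^2 V^2 = 1, with integer
   coefficients v_j (x, s) = x^j + (lower order in x).  For x_i = i L and
   s_i = (-1)^i with 0 <= i < k, let w_i be the minor of the matrix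
   G = (v_j (x_i, s_i)) obtained by deleting its last row and its column i.
   Up to lower order terms in L, G and these minors are Vandermonde matrices
   with increasing nodes, so w_i > 0 and det G > 0 once L is large.  Since the
   cofactors alternate in sign just as the s_i do, Laplace expansion gives
   sum_i w_i s_i v_j (x_i, s_i) = 0 for j < k - 1 and +- det G for j = k - 1.
   Hence sum_i sqrt (w_i^2 ((X + x_i)^2 + 4 s_i)) is an integer plus
   2 det G / X^k + O(X^-(k+1)), and X is taken of order sqrt n. *)

(** * Recursive functions of two arguments and computable sequences *)

Definition recursive2 (g : nat -> nat -> nat) : Prop :=
  recursive (fun v : 2.-tuple nat => g (tnth v ord0) (tnth v ord_max)).

Lemma recursive_op2 g : recursive2 g ->
  forall n (f1 f2 : n.-tuple nat -> nat), recursive f1 -> recursive f2 ->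
  recursive (fun v => g (f1 v) (f2 v)).
Proof.
move=> rg n f1 f2 r1 r2.
apply: (@recursive_comp 2 n _ (fun i : 'I_2 => if i == ord0 then f1 else f2) _ rg).
  by move=> i; case: ifP.
by move=> v; rewrite !tnth_mktuple.
Qed.

Lemma recursive_const n c : recursive (fun _ : n.-tuple nat => c).
Proof.
elim: c => [|c IHc]; first exact: recursive_zero.
apply: (@recursive_comp 1 n (fun v => (thead v).+1) (fun=> fun=> c)) => //.
- exact: recursive_succ.
- by move=> v; rewrite /thead !tnth_mktuple.
Qed.

Lemma recursive_tnth n (i : 'I_n) : recursive (fun v : n.-tuple nat => tnth v i).
Proof. exact: recursive_proj. Qed.

Lemma recursive2_prec (g0 : nat -> nat) (h g : nat -> nat -> nat) :
  recursive (fun v : 1.-tuple nat => g0 (tnth v ord0)) -> recursive2 g ->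
  (forall y, h 0%N y = g0 y) -> (forall x y, h x.+1 y = g (h x y) y) ->
  recursive2 h.
Proof.
move=> r0 rg h0 hS.
apply: (@recursive_prec 1 (fun v => g0 (tnth v ord0))
  (fun v : 3.-tuple nat => g (tnth v (inord 1)) (tnth v (inord 2)))) => //.
- exact: (recursive_op2 rg (recursive_tnth (inord 1 : 'I_3)) (recursive_tnth (inord 2 : 'I_3))).
- by move=> v; rewrite h0; congr g0; rewrite !(tnth_nth 0%N).
- by move=> x v; rewrite !(tnth_nth 0%N) /= !inordK //= hS.
Qed.

Lemma recursive2_add : recursive2 addn.
Proof.
apply: (@recursive2_prec id _ (fun z y => z.+1)) => //.
- exact: recursive_tnth.
- apply: (@recursive_comp 1 2 (fun v => (thead v).+1) (fun=> fun v => tnth v ord0)) => //.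
  + exact: recursive_succ.
  + by move=> _; exact: recursive_tnth.
  + by move=> v; rewrite /thead !tnth_mktuple.
Qed.

Lemma recursive2_mul : recursive2 muln.
Proof.
apply: (@recursive2_prec (fun=> 0%N) _ addn) => //.
- exact: recursive_const.
- exact: recursive2_add.
- by move=> x y; rewrite mulSn addnC.
Qed.

Lemma recursive_add n (f g : n.-tuple nat -> nat) :
  recursive f -> recursive g -> recursive (fun v => f v + g v)%N.
Proof. by move=> rf rg; exact: (recursive_op2 recursive2_add rf rg). Qed.

Lemma recursive_mul n (f g : n.-tuple nat -> nat) :
  recursive f -> recursive g -> recursive (fun v => f v * g v)%N.
Proof. by move=> rf rg; exact: (recursive_op2 recursive2_mul rf rg). Qed.

Lemma recursive_exp n (f g : n.-tuple nat -> nat) :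
  recursive f -> recursive g -> recursive (fun v => f v ^ g v)%N.
Proof.
(* Recursion runs on the first argument, so the exponent is moved there. *)
move=> rf rg; pose h x y := (y ^ x)%N.
suff rh : recursive2 h by exact: (recursive_op2 rh rg rf).
apply: (@recursive2_prec (fun=> 1%N) _ muln) => //.
- exact: recursive_const.
- exact: recursive2_mul.
- by move=> x y; rewrite /h expnS mulnC.
Qed.

(** The approximations are exact, [F k] being F k 2^m / 2^m. Effectiveness of a natural-valued
    constant is thereby reduced to recursiveness. *)
Lemma computable_sequence_nat (R : realType) (F : nat -> nat) :
  recursive (fun v : 2.-tuple nat => F (tnth v ord0)) ->
  computable_sequence (fun k => (F k)%:R : R).
Proof.
move=> rF; exists (fun v => F (tnth v ord0) * 2 ^ tnth v ord_max)%N, (fun=> 0%N).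
split; [|exact: recursive_const|].
  apply: recursive_mul => //; apply: recursive_exp; first exact: recursive_const.
  exact: recursive_tnth.
move=> k m; rewrite !(tnth_nth 0%N) /= subr0 natrM natrX mulfK ?expf_neq0 ?pnatr_eq0//.
by rewrite subrr normr0 invr_ge0 exprn_ge0.
Qed.

(** * The coefficients of V and their size *)

(* [root_coef x s n] is the coefficient v_n (x, s) of V: the course-of-values
   recursion of [root_coefS] is made structural by tabulating v_0, ..., v_n. *)
Fixpoint root_coefs (x s : int) (n : nat) : nat -> int :=
  if n is n'.+1 then
    let c := root_coefs x s n' in
    fun j => if (j <= n')%N then c j
             else x * c n' - s * \sum_(a < n') c a * c (n' - a.+1)%N
  else fun=> 1.

Definition root_coef x s n := root_coefs x s n n.

Lemma root_coefsE x s n j : (j <= n)%N -> root_coefs x s n j = root_coef x s j.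
Proof.
elim: n => [|n IHn]; first by rewrite leqn0 => /eqP ->.
by rewrite leq_eqVlt => /predU1P[->//|]; rewrite ltnS => jn; rewrite /= jn IHn.
Qed.

Lemma root_coef0 x s : root_coef x s 0 = 1.
Proof. by []. Qed.

(** This is the coefficient of t^(n+1) in (1 - x t) V + s t^2 V^2 = 1; the two indices in the sum
    add up to n - 1. *)
Lemma root_coefS x s n : root_coef x s n.+1 = x * root_coef x s n -
  s * \sum_(a < n) root_coef x s a * root_coef x s (n - a.+1)%N.
Proof.
rewrite {1}/root_coef /= ltnn; congr (_ - s * _).
by apply: eq_bigr => a _; rewrite !root_coefsE ?leq_subr// ltnW.
Qed.

Section Bounds.
Variables (x s B L : int) (k : nat).
Hypotheses (x0 : 0 <= x) (s1 : `|s| = 1) (L0 : 0 < L) (LB : L <= B)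
  (xB : x + k%:Z <= B).

Let B1 : 1 <= B. Proof. lia. Qed.

Lemma conv_bound n (c : nat -> int) : (forall a, (a < n)%N -> `|c a| <= B ^+ a) ->
  `|\sum_(a < n) c a * c (n - a.+1)%N| <= n%:Z * B ^+ n.-1.
Proof.
move=> cB; apply: le_trans (ler_norm_sum _ _ _) _.
apply: (@le_trans _ _ (\sum_(a < n) B ^+ n.-1)); last first.
  by rewrite sumr_const card_ord -mulr_natl natz.
apply: ler_sum => a _; rewrite normrM.
have -> : n.-1 = (a + (n - a.+1))%N by have := ltn_ord a; lia.
rewrite exprD ler_pM// cB//; have := ltn_ord a; lia.
Qed.

(** By the recurrence the next coefficient is at most x B^n + n B^(n-1) <= (x + n) B^n, and x + k <=
    B absorbs the factor x + n. *)
Lemma root_coef_bound n : (n <= k)%N -> `|root_coef x s n| <= B ^+ n.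
Proof.
elim/ltn_ind: n => -[_ _|n IHn nk]; first by rewrite root_coef0.
rewrite root_coefS (le_trans (ler_normB _ _))// !normrM s1 mul1r (ger0_norm x0).
have h1 : x * `|root_coef x s n| <= x * B ^+ n by rewrite ler_wpM2l// IHn// ltnW.
have h2 := @conv_bound n (root_coef x s) (fun a an => IHn a (ltnW an) (ltnW (ltn_trans an nk))).
have h3 : B ^+ n.-1 <= B ^+ n by rewrite ler_weXn2l// leq_pred.
rewrite exprS (le_trans (lerD h1 h2))//.
have h4 : 0 <= B ^+ n by rewrite exprn_ge0//; lia.
nia.
Qed.

(** The error v_n - x^n is multiplied by x at each step and gains a convolution of degree only n -
    1; against B^(n+1) this saves a factor B >= L, and n^2 + n <= (n + 1)^2 closes the induction.
    For B = k L it says that v_n / L^n is (x / L)^n + O(1 / L). *)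
Lemma root_coef_pow n : (n <= k)%N ->
  L * `|root_coef x s n - x ^+ n| <= (n ^ 2)%N%:Z * B ^+ n.
Proof.
elim: n => [_|n IHn nk]; first by rewrite root_coef0 subrr normr0 mulr0.
have -> : root_coef x s n.+1 - x ^+ n.+1 = x * (root_coef x s n - x ^+ n)
    - s * \sum_(a < n) root_coef x s a * root_coef x s (n - a.+1)%N.
  by rewrite root_coefS exprS; ring.
have h1 := IHn (ltnW nk).
have h2 : `|\sum_(a < n) root_coef x s a * root_coef x s (n - a.+1)%N| <= n%:Z * B ^+ n.-1.
  by apply: conv_bound => a an; apply: root_coef_bound; lia.
have [h3 h3'] : n%:Z * (B ^+ n.-1) <= n%:Z * B ^+ n /\ 0 <= B ^+ n.
  split; last by rewrite exprn_ge0//; lia.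
  by rewrite ler_wpM2l// ler_weXn2l// leq_pred.
apply: le_trans (_ : L * (x * `|root_coef x s n - x ^+ n| + n%:Z * B ^+ n) <= _).
  rewrite ler_wpM2l ?(ltW L0)// (le_trans (ler_normB _ _))// !normrM s1 mul1r (ger0_norm x0).
  by rewrite lerD2l (le_trans h2).
rewrite exprS mulrDr.
have -> : L * (x * `|root_coef x s n - x ^+ n|) = x * (L * `|root_coef x s n - x ^+ n|) by ring.
have h4 : x * (L * `|root_coef x s n - x ^+ n|) <= B * ((n ^ 2)%N%:Z * B ^+ n).
  by rewrite ler_pM//; [rewrite mulr_ge0// ltW | lia].
have h5 : L * (n%:Z * B ^+ n) <= B * (n%:Z * B ^+ n) by rewrite ler_wpM2r// mulr_ge0.
have h6 : 0 <= B * B ^+ n by rewrite mulr_ge0//; lia.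
rewrite (le_trans (lerD h4 h5))//.
have -> : B * ((n ^ 2)%N%:Z * B ^+ n) + B * (n%:Z * B ^+ n) =
    ((n ^ 2)%N%:Z + n%:Z) * (B * B ^+ n) by ring.
by rewrite ler_wpM2r//; lia.
Qed.

End Bounds.

(** * Perturbation of determinants and comparison with Vandermonde *)

Lemma fact_le_expn n : (n`! <= n ^ n)%N.
Proof.
elim: n => // n IHn; rewrite factS expnS leq_mul2l /= (leq_trans IHn)//.
by case: n {IHn} => // n; rewrite leq_exp2r.
Qed.

Lemma PoszX a n : (a ^ n)%N%:Z = a%:Z ^+ n.
Proof. by rewrite -[LHS]natz natrX natz. Qed.

Section DetBounds.
Variables (F : realDomainType) (H e : F).
Hypotheses (H1 : 1 <= H) (e0 : 0 <= e).

Lemma norm_prod_le n (f : 'I_n -> F) : (forall i, `|f i| <= H) ->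
  `|\prod_i f i| <= H ^+ n.
Proof.
move=> fH; rewrite normr_prod -[X in H ^+ X]card_ord -prodr_const.
by apply: ler_prod => i _; rewrite normr_ge0 fH.
Qed.

(** Telescoping: the factors are exchanged one at a time, each exchange costing e times a power of H
    that H >= 1 allows to round up. *)
Lemma norm_prodB_le n (f g : 'I_n -> F) : (forall i, `|f i| <= H) ->
  (forall i, `|g i| <= H) -> (forall i, `|f i - g i| <= e) ->
  `|\prod_i f i - \prod_i g i| <= n%:R * e * H ^+ n.
Proof.
elim: n f g => [|n IHn] f g fH gH fg; first by rewrite !big_ord0 subrr normr0 !mul0r.
rewrite !big_ord_recl.
set P := \prod_(i < n) _; set Q := \prod_(i < n) _.
have -> : f ord0 * P - g ord0 * Q = (f ord0 - g ord0) * P + g ord0 * (P - Q) by ring.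
have h1 : `|P| <= H ^+ n by apply: norm_prod_le.
have h2 : `|P - Q| <= n%:R * e * H ^+ n by apply: IHn.
rewrite (le_trans (ler_normD _ _))// !normrM.
have h3 : `|f ord0 - g ord0| * `|P| <= e * H ^+ n by rewrite ler_pM.
have h4 : `|g ord0| * `|P - Q| <= H * (n%:R * e * H ^+ n) by rewrite ler_pM.
have h5 : 0 <= e * H ^+ n by rewrite mulr_ge0// exprn_ge0// (le_trans _ H1).
have h6 : e * H ^+ n <= H * (e * H ^+ n) by rewrite ler_peMl.
rewrite (le_trans (lerD h3 h4))// (le_trans (lerD h6 (lexx _)))//.
by rewrite exprS -natr1 le_eqVlt; apply/orP; left; apply/eqP; ring.
Qed.

Lemma norm_det_le n (A : 'M[F]_n) : (forall i j, `|A i j| <= H) ->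
  `|\det A| <= n`!%:R * H ^+ n.
Proof.
move=> AH; rewrite (le_trans (ler_norm_sum _ _ _))//.
rewrite (@le_trans _ _ (\sum_(s : 'S_n) H ^+ n))//; last first.
  by rewrite sumr_const card_Sn [leRHS]mulr_natl.  
by apply: ler_sum => s _; rewrite normrM normr_sign mul1r norm_prod_le.
Qed.

Lemma norm_detB_le n (A B : 'M[F]_n) : (forall i j, `|A i j| <= H) ->
  (forall i j, `|B i j| <= H) -> (forall i j, `|A i j - B i j| <= e) ->
  `|\det A - \det B| <= n`!%:R * (n%:R * e * H ^+ n).
Proof.
move=> AH BH AB; rewrite /determinant -sumrB (le_trans (ler_norm_sum _ _ _))//.
rewrite (@le_trans _ _ (\sum_(s : 'S_n) (n%:R * e * H ^+ n)))//; last first.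
  by rewrite sumr_const card_Sn [leRHS]mulr_natl.  
apply: ler_sum => s _.
by rewrite -mulrBr normrM normr_sign mul1r norm_prodB_le.
Qed.

End DetBounds.

(** The determinant is a product of differences of increasing naturals, each a positive integer. *)
Lemma det_Vandermonde_nat_ge1 (F : realFieldType) n (f : 'I_n -> nat) :
  {homo f : a b / (a < b)%N} ->
  1 <= \det (\matrix_(j < n, b < n) (f b)%:R ^+ j : 'M[F]_n).
Proof.
move=> f_mono.
have -> : (\matrix_(j < n, b < n) (f b)%:R ^+ j : 'M[F]_n) =
    Vandermonde n (\row_b (f b)%:R).
  by apply/matrixP => j b; rewrite !mxE.
rewrite det_Vandermonde.
apply: (big_ind (fun x : F => 1 <= x)) => // [x y x1 y1|a _]; first exact: mulr_ege1.
apply: (big_ind (fun x : F => 1 <= x)) => // [x y x1 y1|b ab]; first exact: mulr_ege1.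
have fab := f_mono _ _ ab.
by rewrite !mxE -natrB ?(ltnW fab)// ler1n subn_gt0.
Qed.

(* Large enough for the scaled determinant in [root_det_gt0] to differ from a
   Vandermonde determinant, which is a positive integer, by less than 1. *)
Definition spacing k := (k ^ k * k * (k ^ k) ^ k * (k ^ 2 * k ^ k) + 1)%N.

Lemma spacing_gt0 k : (0 < spacing k)%N.
Proof. by rewrite /spacing addn1. Qed.

Lemma spacing_ge k : (k <= spacing k)%N.
Proof.
case: k => // k; rewrite /spacing addn1 ltnW// ltnS.
rewrite -!mulnA [X in (_ <= X)%N]mulnCA leq_pmulr//.
by rewrite !muln_gt0 !expn_gt0.
Qed.

(** Dividing row j by L^j gives a matrix [A] close to the Vandermonde matrix [V] of the numbers
    [f b]; the determinants differ by less than 1 while that of [V] is at least 1. A general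
    increasing [f] covers both G and its minors. *)
Lemma root_det_gt0 k n (f : 'I_n -> nat) (s : 'I_n -> int) :
  (n <= k)%N -> (forall b, (f b < k)%N) -> {homo f : a b / (a < b)%N} ->
  (forall b, `|s b| = 1) ->
  0 < \det (\matrix_(j < n, b < n) root_coef (f b * spacing k)%:Z (s b) j).
Proof.
move=> nk fk f_mono s1; set L := spacing k.
set G := \matrix_(j, b) _.
have [k0|k0] := posnP k.
  by move: (G); rewrite k0 in nk; case: n nk f {s s1 G fk f_mono} => // _ _ G; rewrite det_mx00.
have L0 : 0 < L%:R :> rat by rewrite ltr0n spacing_gt0.
pose A : 'M[rat]_n := \matrix_(j, b) ((G j b)%:~R / L%:R ^+ j).
pose V : 'M[rat]_n := \matrix_(j, b) (f b)%:R ^+ j.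
have GA : (\det G)%:~R = (\prod_(j < n) L%:R ^+ j) * \det A.
  have -> : \prod_(j < n) L%:R ^+ j = \det (diag_mx (\row_(j < n) (L%:R ^+ j : rat))).
    by rewrite det_diag; apply: eq_bigr => j _; rewrite mxE.
  rewrite -det_mulmx -det_map_mx; congr (\det _); apply/matrixP => j b.
  by rewrite mul_diag_mx !mxE mulrC divfK// expf_neq0// gt_eqF.
suff A0 : 0 < \det A.
  rewrite -(ltr0z rat) GA mulr_gt0// prodr_gt0// => j _; exact: exprn_gt0.
have kk1 : 1 <= (k ^ k)%N%:R :> rat by rewrite ler1n expn_gt0 k0.
have expk (j : 'I_n) : (k ^ j <= k ^ k)%N.
  by rewrite leq_pexp2l// (leq_trans (ltnW (ltn_ord j))).
(* The hypotheses of the coefficient bounds at x = f b L and B = k L: x + L <= k L because f b < k,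
   and k <= L. *)
have side b : [/\ 0 <= (f b * L)%:Z, 0 < L%:Z, L%:Z <= (k * L)%:Z &
    (f b * L)%:Z + k%:Z <= (k * L)%:Z].
  have := fk b; have := spacing_ge k; rewrite -/L => kL fbk.
  have : ((f b).+1 * L <= k * L)%N by rewrite leq_mul2r fbk orbT.
  by split; rewrite ?lez_nat//; nia.
have BL (j : nat) : (k * L)%:R ^+ j / L%:R ^+ j = (k ^ j)%N%:R :> rat.
  by rewrite natrM exprMn mulfK ?expf_neq0 ?gt_eqF// natrX.
have Lj0 (j : nat) : 0 < L%:R ^+ j :> rat by rewrite exprn_gt0.
have intr_le (x : int) (c : nat) : `|x| <= c%:Z -> `|x%:~R| <= c%:R :> rat.
  by move=> xc; rewrite -intr_norm -[c%:R]/(c%:Z%:~R) ler_int.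
have AH j b : `|A j b| <= (k ^ k)%N%:R.
  rewrite !mxE normrM normfV (ger0_norm (ltW (Lj0 _))).
  apply: (@le_trans _ _ (k ^ j)%N%:R); last by rewrite ler_nat expk.
  rewrite -BL ler_pM2r ?invr_gt0// -natrX; apply: intr_le.
  have [h1 h2 h3 h4] := side b.
  have := root_coef_bound h1 (s1 b) h2 h3 h4 (leq_trans (ltnW (ltn_ord j)) nk).
  by rewrite PoszX.
have VH j b : `|V j b| <= (k ^ k)%N%:R.
  rewrite mxE ger0_norm ?exprn_ge0// -natrX ler_nat.
  by rewrite (leq_trans _ (expk j))//; case: (nat_of_ord j) => // i; rewrite leq_exp2r// ltnW.
have AV j b : `|A j b - V j b| <= (k ^ 2 * k ^ k)%N%:R / L%:R.
  rewrite !mxE.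
  have -> : (f b)%:R ^+ j = ((f b * L)%:Z ^+ j)%:~R / L%:R ^+ j :> rat.
    by rewrite rmorphXn /= -pmulrn natrM exprMn mulfK// gt_eqF.
  rewrite -mulrBl -intrB normrM normfV (ger0_norm (ltW (Lj0 _))).
  rewrite ler_pdivlMr// mulrAC ler_pdivrMr// -[L%:R]/(L%:Z%:~R) -intr_norm -intrM.
  have [h1 h2 h3 h4] := side b.
  have := root_coef_pow h1 (s1 b) h2 h3 h4 (leq_trans (ltnW (ltn_ord j)) nk).
  rewrite mulrC -(ler_int rat) => /le_trans; apply.
  have -> : ((j ^ 2)%N%:Z * (k * L)%N%:Z ^+ j)%:~R = (j ^ 2 * k ^ j)%N%:R * L%:R ^+ j :> rat.
    by rewrite intrM rmorphXn /= -!pmulrn (natrM _ k L) exprMn (natrM _ (j ^ 2)) (natrX _ k) mulrA.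
  rewrite ler_pM2r// ler_nat leq_mul// leq_exp2r//.
  by rewrite (leq_trans (ltnW (ltn_ord j))).
have e0 : 0 <= (k ^ 2 * k ^ k)%N%:R / L%:R :> rat by rewrite divr_ge0.
have := norm_detB_le kk1 e0 AH VH AV.
have V1 : 1 <= \det V := det_Vandermonde_nat_ge1 _ f_mono.
suff small : n`!%:R * (n%:R * ((k ^ 2 * k ^ k)%N%:R / L%:R) * (k ^ k)%N%:R ^+ n) < 1 :> rat.
  by rewrite ler_norml; lra.
(* By n! <= n^n <= k^k and n <= k, the numerator is at most [spacing k] - 1. *)
rewrite /L /spacing; set c := (k ^ 2 * k ^ k)%N; set h := (k ^ k)%N.
have regroup (a b c' h' : nat) (l : rat) : a%:R * (b%:R * (c'%:R / l) * h'%:R ^+ n) =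
    (a * b * h' ^ n * c')%N%:R / l.
  by rewrite !natrM natrX; ring.
rewrite regroup.
rewrite ltr_pdivrMr ?ltr0n ?addn1// mul1r ltr_nat ltnS leq_mul2r; apply/orP; right.
rewrite leq_mul//.
  rewrite leq_mul// (leq_trans (fact_le_expn n))// (@leq_trans (k ^ n))//.
    by case: (n) nk => // n' nk'; rewrite leq_exp2r.
  by rewrite leq_pexp2l.
by rewrite leq_pexp2l// expn_gt0 k0.
Qed.

(** * Integer weights from the minors of G *)

Definition coef_bound k := ((k * spacing k) ^ k)%N.
(** The Leibniz bound, with k! replaced by k^k, for determinants of order at most k with entries at
    most [coef_bound k]. *)
Definition weight_bound k := (k ^ k * coef_bound k ^ k)%N.

Definition node_coef k i j := root_coef (i * spacing k)%:Z ((-1) ^+ i) j.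

Lemma node_coef_bound k i j : (i < k)%N -> (j <= k)%N ->
  `|node_coef k i j| <= (coef_bound k)%:Z.
Proof.
move=> ik jk; have kL := spacing_ge k.
have h : (i.+1 * spacing k <= k * spacing k)%N by rewrite leq_mul2r ik orbT.
have B1 : (0 < k * spacing k)%N by rewrite muln_gt0 (leq_ltn_trans _ ik) ?spacing_gt0.
have L0 := spacing_gt0 k.
have := @root_coef_bound (i * spacing k)%:Z ((-1) ^+ i) (k * spacing k)%:Z (spacing k)%:Z k.
move=> /(_ isT _ L0 _ _ j jk) H.
apply: le_trans (H _ _ _) _.
- by rewrite normrX normrN1 expr1n.
- by rewrite lez_nat leq_pmull// (leq_ltn_trans _ ik).
- by nia.
- by rewrite -PoszX lez_nat leq_pexp2l.
Qed.

(** [D] is det G. The sign (-1)^(k-1) will cancel against that of (-1/X)^(k-1). *)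
Lemma exists_weights k : (0 < k)%N ->
  exists (w : 'I_k -> nat) (D : nat),
    [/\ forall i, (0 < w i <= weight_bound k)%N, (0 < D <= weight_bound k)%N &
     forall j, (j < k)%N ->
       \sum_(i < k) (w i)%:Z * ((-1) ^+ i * node_coef k i j) =
         (-1) ^+ k.-1 * (if j == k.-1 then D%:Z else 0)].
Proof.
case: k => // m _; set k := m.+1.
pose G := \matrix_(j < k, i < k) node_coef k i j.
pose M (i : 'I_k) := \det (row' ord_max (col' i G)).
have E1 : (0 < coef_bound k)%N by rewrite expn_gt0 muln_gt0 spacing_gt0.
have det_bound n (A : 'M[int]_n) : (n <= k)%N ->
    (forall i j, `|A i j| <= (coef_bound k)%:Z) -> \det A <= (weight_bound k)%:Z.
  move=> nk /norm_det_le AE; apply: le_trans (ler_norm _) (le_trans AE _).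
  rewrite -PoszX natz -PoszM lez_nat leq_mul//; last by rewrite leq_pexp2l.
  rewrite (leq_trans (fact_le_expn n))// (@leq_trans (k ^ n))//.
    by case: (n) nk => // n' nk'; rewrite leq_exp2r.
  by rewrite leq_pexp2l.
have sgn1 i : `|(-1 : int) ^+ i| = 1 by rewrite normrX normrN1 expr1n.
have G0 : 0 < \det G.
  by apply: (@root_det_gt0 k k (fun b => b) (fun b => (-1) ^+ b)).
have M0 i : 0 < M i.
  (* [lift i] enumerates the columns other than i in increasing order, so the minor is again such a
     determinant, of order m. *)
  have := @root_det_gt0 k m (fun b => lift i b) (fun b => (-1) ^+ lift i b) (leqnSn m).
  rewrite /M => /(_ (fun b => ltn_ord _) _ (fun b => sgn1 _)) H.
  have -> : row' ord_max (col' i G) = \matrix_(j, b) root_coef (lift i b * spacing k)%:Z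
      ((-1) ^+ lift i b) j.
    by apply/matrixP => j b; rewrite !mxE /node_coef lift_max.
  by apply: H => a b ab; rewrite /= /bump; lia.
have Gb i j : `|G i j| <= (coef_bound k)%:Z by rewrite mxE node_coef_bound// ltnW.
exists (fun i => `|M i|%N), `|\det G|%N; split.
- move=> i; rewrite absz_gt0 gt_eqF//= -lez_nat (gez0_abs (ltW (M0 i))).
  by apply: det_bound => // a b; rewrite 2!mxE.
- by rewrite absz_gt0 gt_eqF//= -lez_nat (gez0_abs (ltW G0)) det_bound.
(* Column [ord_max] of G adj G = (det G) I pairs row j of G with the cofactors of the last row,
   whose signs (-1)^(m+i) split into (-1)^m and s_i. *)
move=> j jk; have /matrixP/(_ (Ordinal jk) ord_max) := mul_mx_adj G.
rewrite !mxE => GE; rewrite -[RHS]mulr1.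
have -> : (if j == k.-1 then `|\det G|%:Z else 0) = \det G *+ (Ordinal jk == ord_max).
  by rewrite -val_eqE /=; case: eqP => // _; rewrite gez0_abs ?ltW.
rewrite -GE mulr1 mulr_sumr; apply: eq_bigr => i _.
rewrite !mxE /cofactor (gez0_abs (ltW (M0 i))) exprD -/(M i) /=.
rewrite -/(node_coef _ _ _) mulrCA mulrA.
have -> : (-1) ^+ m * (node_coef k i j * ((-1) ^+ m * (-1) ^+ i * M i)) =
   ((-1) ^+ m * (-1) ^+ m) * (M i * ((-1) ^+ i * node_coef k i j)) :> int by ring.
by rewrite -expr2 sqrr_sign mul1r mulrCA mulrA.
Qed.

(** * The truncated series and the expansion of the square root *)

Lemma horner_tail_le (F : realFieldType) (p : {poly int}) (c : int) d n (t : F) :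
  (forall l, (l < d)%N -> p`_l = 0) -> (forall l, `|p`_l| <= c) ->
  (size p <= n)%N -> `|t| <= 1 ->
  `|(map_poly intr p).[t]| <= n%:R * c%:~R * `|t| ^+ d.
Proof.
move=> p0 pc sp t1.
rewrite (@horner_coef_wide _ n); last by rewrite (leq_trans (size_poly _ _)).
rewrite (le_trans (ler_norm_sum _ _ _))// -mulrA mulr_natl -[n in leRHS]card_ord -sumr_const.
have c0 : 0 <= c by apply: le_trans (pc 0%N).
apply: ler_sum => l _; rewrite coef_map /= normrM normrX -intr_norm.
have [ld|dl] := ltnP l d; first by rewrite p0// normr0 mul0r mulr_ge0 ?ler0z// exprn_ge0.
by rewrite ler_pM ?ler0z// ?exprn_ge0// ?ler_int// ler_wiXn2l.
Qed.

Section Residual.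
Variables (x s E B : int) (k : nat).
Hypotheses (k0 : (0 < k)%N) (s1 : `|s| = 1) (x0 : 0 <= x) (xB : x <= B) (E1 : 1 <= E) (B1 : 1 <= B)
  (vE : forall j, (j < k)%N -> `|root_coef x s j| <= E).

Let V : {poly int} := \poly_(j < k) root_coef x s j.
Let p := V - x *: ('X * V) + s *: ('X^2 * (V * V)) - 1.

Let Vl l : `|V`_l| <= E.
Proof. by rewrite coef_poly; case: ifP => [/vE//|_]; rewrite normr0; lia. Qed.

(** [p] is what the truncation [V] leaves in the quadratic equation; below degree k it sees only
    untruncated coefficients, which the recurrence cancels. *)
Lemma residual_coef_eq0 l : (l < k)%N -> p`_l = 0.
Proof.
move=> lk; rewrite !(coefB, coefD, coefZ) coefXM coefXnM coefC.
case: l lk => [|n] nk /=; first by rewrite coef_poly k0 root_coef0; ring.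
rewrite !coef_poly nk (ltnW nk) root_coefS coefM.
case: n nk => [|n] nk /=; first by rewrite big_ord0; ring.
rewrite -addn2 addnK.
have -> : \sum_(j < n.+1) V`_j * V`_(n - j) =
    \sum_(a < n.+1) root_coef x s a * root_coef x s (n.+1 - a.+1)%N.
  apply: eq_bigr => a _; have := ltn_ord a => an.
  by rewrite !coef_poly !ifT ?subSS//; lia.
by ring.
Qed.

(** The four terms contribute at most E, B E, 2 k E^2 and 1, all absorbed into multiples of B E^2
    since B, E >= 1. *)
Lemma residual_coef_le l : `|p`_l| <= (2 * k + 3)%N%:Z * (B * E ^+ 2).
Proof.
rewrite !(coefB, coefD, coefZ) coefXM coefXnM coefC.
have h1 : `|V`_l| <= E := Vl _.
have h2 : `|x * (if (l == 0)%N then 0 else V`_l.-1)| <= B * E.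
  rewrite normrM (ger0_norm x0); case: ifP => _; last by rewrite ler_pM.
  by rewrite normr0 mulr0; nia.
have h3 : `|(l == 0%N)%:R : int| <= 1 by case: eqP.
have h4 : `|s * (if (l < 2)%N then 0 else (V * V)`_(l - 2))| <= (2 * k)%N%:Z * E ^+ 2.
  rewrite normrM s1 mul1r; case: ifP => _; first by rewrite normr0; nia.
  (* If l - 2 >= 2 k, every product has an index at least k and vanishes; otherwise there are at
     most 2 k products. *)
  rewrite coefM; have [lk|kl] := leqP (2 * k) (l - 2).
    rewrite big1 ?normr0; first by nia.
    move=> a _; rewrite !coef_poly; have := ltn_ord a => al.
    by case: ifP => ak; rewrite ?mul0r// ifF ?mulr0//; lia.
  apply: le_trans (ler_norm_sum _ _ _) _.
  apply: (@le_trans _ _ (\sum_(a < (l - 2).+1) E ^+ 2)).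
    by apply: ler_sum => a _; rewrite normrM expr2 ler_pM.
  rewrite sumr_const card_ord -[leLHS]mulr_natl natz ler_wpM2r//; nia.
have h5 : E <= B * E ^+ 2 by nia.
have h6 : B * E <= B * E ^+ 2 by nia.
have h7 : E ^+ 2 <= B * E ^+ 2 by nia.
have h8 : (2 * k)%N%:Z * E ^+ 2 <= (2 * k)%N%:Z * (B * E ^+ 2) by rewrite ler_wpM2l.
have h9 : (l == 0%N)%:R = (if (l == 0)%N then 1 else 0) :> int by case: (l == 0)%N.
rewrite -h9.
set a := V`_l in h1 *; set b := (x * _) in h2 *; set c := s * _ in h4 *.
set d := _%:R in h3 *.
have : `|a - b + c - d| <= E + B * E + (2 * k)%N%:Z * E ^+ 2 + 1.
  apply: le_trans (ler_normB _ _) _; rewrite lerD//.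
  apply: le_trans (ler_normD _ _) _; rewrite lerD//.
  by apply: le_trans (ler_normB _ _) _; rewrite lerD.
nia.
Qed.

Lemma residual_size : (size p <= 2 * k + 1)%N.
Proof.
have sV : (size V <= k)%N by exact: size_poly.
have sVV : (size (V * V)%R <= (2 * k).-1)%N.
  by apply: leq_trans (size_polyMleq _ _) _; lia.
have sX : size ('X : {poly int}) = 2%N := size_polyX _.
have sX2 : size ('X^2 : {poly int}) = 3%N := size_polyXn _ _.
have h1 : (size (x *: ('X * V))%R <= 2 * k + 1)%N.
  rewrite (leq_trans (size_scale_leq _ _))// (leq_trans (size_polyMleq _ _))// sX.
  by apply: (@leq_trans k.+1); [exact: sV|lia].
have h2 : (size (s *: ('X^2 * (V * V)))%R <= 2 * k + 1)%N.
  rewrite (leq_trans (size_scale_leq _ _))// (leq_trans (size_polyMleq _ _))// sX2.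
  by apply: (@leq_trans (2 * k).-1.+2); [exact: sVV|lia].
have h3 : (size (1%R : {poly int}) <= 2 * k + 1)%N by rewrite size_poly1; lia.
have sB (q r : {poly int}) : (size q <= 2 * k + 1)%N -> (size r <= 2 * k + 1)%N ->
    (size (q - r)%R <= 2 * k + 1)%N.
  by move=> q1 r1; rewrite (leq_trans (size_polyD _ _))// geq_max q1 size_polyN.
have sD (q r : {poly int}) : (size q <= 2 * k + 1)%N -> (size r <= 2 * k + 1)%N ->
    (size (q + r)%R <= 2 * k + 1)%N.
  by move=> q1 r1; rewrite (leq_trans (size_polyD _ _))// geq_max q1.
by apply: (sB _ _ (sD _ _ (sB _ _ _ h1) h2) h3); lia.
Qed.

(** At most 2 k + 1 coefficients remain, none below degree k, and |t| <= 1 bounds every higher power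
    by |t|^k. *)
Lemma residual_le (F : realFieldType) (t : F) (v := \sum_(j < k) (root_coef x s j)%:~R * t ^+ j) :
  `|t| <= 1 ->
  `|v - x%:~R * t * v + s%:~R * t ^+ 2 * v ^+ 2 - 1| <=
    ((2 * k + 1)%N%:Z * ((2 * k + 3)%N%:Z * (B * E ^+ 2)))%:~R * `|t| ^+ k.
Proof.
move=> t1.
have vV : (map_poly intr V).[t] = v.
  rewrite (@horner_coef_wide _ k).
    by apply: eq_bigr => j _; rewrite coef_map /= coef_poly ltn_ord.
  by rewrite (leq_trans (size_poly _ _))// size_poly.
have := horner_tail_le residual_coef_eq0 residual_coef_le residual_size t1.
rewrite /p rmorphB rmorphD rmorphB /= !map_polyZ !rmorphM /= map_polyX rmorph1.
rewrite !(hornerD, hornerN, hornerZ, hornerM, hornerX, hornerC) vV /=.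
have -> : v - x%:~R * (t * v) + s%:~R * (t * t * (v * v)) - 1 =
  v - x%:~R * t * v + s%:~R * t ^+ 2 * v ^+ 2 - 1 by ring.
by [].
Qed.

End Residual.

(** At t = -1/X, with residual r, the difference of squares y^2 - Q^2 is exactly -4 s r because s^2
    = 1. Dividing by y + Q >= X / 2 gives the bound. *)
Lemma sqrt_approx (F : rcfType) (X x s v c : F) :
  2 <= X -> 0 <= x -> `|s| = 1 -> `|v| <= X / 4 ->
  `|v - x * (- X^-1) * v + s * (- X^-1) ^+ 2 * v ^+ 2 - 1| <= c ->
  `|Num.sqrt ((X + x) ^+ 2 + 4 * s) - (X + x + 2 * s * v / X)| <= 8 * c / X.
Proof.
move=> X2 x0 s1 vX; set r := _ - 1 => rc.
set y := Num.sqrt _; set Q := X + x + _.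
have X0 : X != 0 by apply: lt0r_neq0; lra.
have ss : s ^+ 2 = 1 by rewrite -real_normK ?num_real// s1 expr1n.
have [sl sr] : -1 <= s /\ s <= 1 by move: (ler_norm s) (ler_norm (- s)); rewrite normrN s1; lra.
have A0 : 0 <= (X + x) ^+ 2 + 4 * s by nra.
have y0 : 0 <= y by exact: sqrtr_ge0.
have diff : (y - Q) * (y + Q) = - 4 * s * r.
  have -> : (y - Q) * (y + Q) = y ^+ 2 - Q ^+ 2 by ring.
  rewrite sqr_sqrtr// /Q /r; move: ss; rewrite expr2 => ss.
  have -> : (X + x + 2 * s * v / X) ^+ 2 =
     (X + x) ^+ 2 + 4 * s * (X + x) * v / X + 4 * (s * s) * v ^+ 2 / X ^+ 2 by field.
  have -> : - 4 * s * (v - x * (- X^-1) * v + s * (- X^-1) ^+ 2 * v ^+ 2 - 1) =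
    - 4 * s * v - 4 * s * x * v / X - 4 * (s * s) * v ^+ 2 / X ^+ 2 + 4 * s by field.
  by rewrite ss; field.
have q : `|2 * s * v / X| <= 1 / 2.
  rewrite !normrM s1 normfV (ger0_norm (_ : 0 <= X)) ?ler_pdivrMr//; last 2 first.
  - by lra.
  - by lra.
  by rewrite ger0_norm//; lra.
have yQ : X / 2 <= y + Q.
  by have := ler_norm (- (2 * s * v / X)); rewrite normrN /Q; lra.
have X20 : 0 < X / 2 by lra.
have n1 : `|y - Q| * (y + Q) <= 4 * c.
  have -> : y + Q = `|y + Q| by rewrite ger0_norm//; lra.
  by rewrite -normrM diff !normrM s1 normrN normr_nat; lra.
rewrite ler_pdivlMr; last by lra.
have := ler_wpM2l (normr_ge0 (y - Q)) yQ; lra.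
Qed.

(** * Distance to the integers and choice of the constants *)

(** The minimum is attained, so it vanishes only at an integer, and no integer lies strictly between
    0 and 1 away from [z]. *)
Lemma dist_int_gt0 (R : realType) (x : R) (z : int) :
  0 < `|x - z%:~R| < 1 -> 0 < dist_int x.
Proof.
move=> /andP[xz0 xz1]; have [m ->] := dist_int_attained x.
rewrite normr_gt0; apply/eqP => /subr0_eq xm; move: xz0 xz1.
by rewrite xm -intrB -intr_norm ltr0z ltrz1; lia.
Qed.

Lemma powR_half (R : realType) (n k : nat) :
  n%:R `^ (- (k%:R / 2)) = (Num.sqrt n%:R ^+ k)^-1 :> R.
Proof.
by rewrite powRN mulrC powRrM powR12_sqrt// powR_mulrn// sqrtr_ge0.
Qed.

(** The witness is the integer part of sqrt n / d, which increases by at most one from n to n +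
    1. *)
Lemma exists_scaled_sqrtn d n : (0 < d)%N ->
  exists X, ((d * X) ^ 2 <= n < (d * X.+1) ^ 2)%N.
Proof.
move=> d0; elim: n => [|n [X /andP[Xn nX]]].
  by exists 0%N; rewrite muln0 muln1 expn_gt0 d0.
have [h|h] := ltnP n.+1 ((d * X.+1) ^ 2); first by exists X; rewrite h leqW.
exists X.+1; rewrite h (leq_ltn_trans nX)// ltn_exp2r// ltn_pmul2l//.
Qed.

(** The constant of [residual_le] at B = k L and E = [coef_bound k]. *)
Definition residual_bound k :=
  ((2 * k + 1) * ((2 * k + 3) * (k * spacing k * coef_bound k ^ 2)))%N.

(** The summands ensure in turn: total error at most X^-k, nodes at most X, |v| <= X / 4, and a
    final distance below 1. *)
Definition threshold k := (8 * k * weight_bound k * residual_bound k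
  + k * spacing k + 4 * k * coef_bound k + 2 * weight_bound k + 4)%N.

(** The first summand serves X >= [threshold k], where sqrt n <= 4 W X with W = [weight_bound k];
    the second makes the claimed bound at least 1 for smaller X. *)
Definition approx_const k := ((2 * weight_bound k + 1) * (4 * weight_bound k) ^ k
  + (2 * weight_bound k * threshold k) ^ k)%N.

Lemma recursive_approx_const :
  recursive (fun v : 2.-tuple nat => approx_const (tnth v ord0)).
Proof.
rewrite /approx_const /threshold /residual_bound /weight_bound /coef_bound /spacing.
by repeat first [exact: recursive_const | exact: recursive_tnth
  | apply: recursive_add | apply: recursive_mul | apply: recursive_exp].
Qed.

Lemma threshold_le k X : (threshold k <= X)%N ->
  [/\ (8 * k * weight_bound k * residual_bound k <= X)%N,
  (k * spacing k <= X)%N, (4 * k * coef_bound k <= X)%N,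
  (2 * weight_bound k + 2 <= X)%N & (4 <= X)%N].
Proof. by rewrite /threshold => h; split; lia. Qed.

(** * The weighted sum of square roots *)

Section SumOfRoots.
Variables (R : realType) (k X : nat).
Hypotheses (k0 : (0 < k)%N) (thX : (threshold k <= X)%N).

Let sgn i : int := (-1) ^+ i.
Let x i := (i * spacing k)%N.
Let v i : R := \sum_(j < k) (node_coef k i j)%:~R * (- X%:R^-1) ^+ j.
Let root i : R := Num.sqrt ((X%:R + (x i)%:R) ^+ 2 + 4 * (sgn i)%:~R).

Let X_gt0 : 0 < X%:R :> R.
Proof. by have [_ _ _ _ X4] := (threshold_le thX); rewrite ltr0n; lia. Qed.

Let normX1 : `|- X%:R^-1| <= 1 :> R.
Proof.
have [_ _ _ _ X4] := threshold_le thX.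
by rewrite normrN normfV normr_nat invf_le1// ler1n; lia.
Qed.

(** The residual at t = -1/X is of order X^-k, and [sqrt_approx] gains one more factor 1/X. *)
Lemma root_approx i : (i < k)%N ->
  `|root i - (X%:R + (x i)%:R + 2 * (sgn i)%:~R * v i / X%:R)|
    <= 8 * (residual_bound k)%:R / X%:R ^+ k.+1.
Proof.
move=> ik; have [_ kX EX _ X4] := threshold_le thX.
have sgn1 : `|sgn i| = 1 by rewrite normrX normrN1 expr1n.
rewrite exprSr invfM mulrA -(mulrA 8).
apply: sqrt_approx.
- by rewrite ler_nat; lia.
- by [].
- by rewrite -intr_norm sgn1.
- rewrite (@le_trans _ _ (k * coef_bound k)%N%:R)//; last first.
    by rewrite ler_pdivlMr// -natrM ler_nat; lia.
  rewrite (le_trans (ler_norm_sum _ _ _))//.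
  have -> : (k * coef_bound k)%N%:R = \sum_(j < k) (coef_bound k)%:R :> R.
    by rewrite sumr_const card_ord natrM mulr_natl.
  apply: ler_sum => j _; rewrite normrM normrX -[leRHS]mulr1.
  rewrite ler_pM ?exprn_ile1 ?exprn_ge0//.
  by rewrite -intr_norm -[leRHS]/((coef_bound k)%:Z%:~R) ler_int node_coef_bound// ltnW.
- have E1 : 1 <= (coef_bound k)%:Z by rewrite lez_nat expn_gt0 muln_gt0 k0 spacing_gt0.
  have B1 : 1 <= (k * spacing k)%:Z by rewrite lez_nat muln_gt0 k0 spacing_gt0.
  have xB : (x i)%:Z <= (k * spacing k)%:Z by rewrite lez_nat leq_mul2r (ltnW ik) orbT.
  have vE j : (j < k)%N -> `|root_coef (x i)%:Z (sgn i) j| <= (coef_bound k)%:Z.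
    by move=> jk; apply: node_coef_bound => //; exact: ltnW.
  have := residual_le k0 sgn1 (isT : 0 <= (x i)%:Z) xB E1 B1 vE normX1.
  by rewrite normrN normfV normr_nat -PoszX -!PoszM -exprVn.
Qed.

(** The main term 2 D X^-k is at least 2 X^-k and the error at most X^-k, which keeps the sum away
    from the integer. *)
Lemma exists_almost_integer_sum : exists (a : 'I_k -> nat) (z : int),
  (forall j, 1 <= a j <= (2 * weight_bound k * X) ^ 2)%N /\
  (X%:R ^+ k)^-1 <= `|\sum_(j < k) Num.sqrt (a j)%:R - z%:~R : R|
     <= (2 * weight_bound k + 1)%N%:R / X%:R ^+ k.
Proof.
have [TX kX EX NX X4] := threshold_le thX.
have [w [D [wN /andP[D0 DN] wD]]] := exists_weights k0.
have {}wD j : (j < k)%N -> \sum_(i < k) (w i)%:Z * (sgn i * node_coef k i j) =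
    (-1) ^+ k.-1 * (if j == k.-1 then D%:Z else 0) by exact: wD.
pose A i : int := ((X + x i) ^ 2)%N%:Z + 4 * sgn i.
pose a (i : 'I_k) := (w i ^ 2 * absz (A i))%N.
have sgnE i : sgn i = 1 \/ sgn i = -1.
  by rewrite /sgn -signr_odd; case: odd; [right|left].
have A0 i : 0 < A i.
  by rewrite /A; have [->|->] := sgnE i; nia.
(* The integer collects the parts X + x_i of the roots, with their weights. *)
exists a, (\sum_(i < k) (w i)%:Z * (X + x i)%N%:Z); split => [j|].
  have /andP[w0 wj] := wN j.
  (* The two spare units absorb the 4 in (X + x_j)^2 + 4 <= (2 X)^2. *)
  have xX : (x j + 2 <= X)%N.
    have : (j.+1 * spacing k <= k * spacing k)%N by rewrite leq_mul2r ltn_ord orbT.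
    rewrite mulSn -/(x j); have := spacing_ge k; have := ltn_ord j.
    by case: (posnP j) => [j0|]; [rewrite /x j0|]; lia.
  apply/andP; split; first by rewrite /a muln_gt0 expn_gt0 w0 absz_gt0 (gt_eqF (A0 j)).
  have h : (absz (A j) <= (2 * X) ^ 2)%N.
    by rewrite -lez_nat (gez0_abs (ltW (A0 j))) /A; have [->|->] := sgnE j; nia.
  rewrite (@leq_trans (weight_bound k ^ 2 * (2 * X) ^ 2))//.
    by rewrite leq_mul// leq_exp2r.
  by rewrite -expnMn mulnCA mulnA.
have aE i : Num.sqrt (a i)%:R = (w i)%:R * root i.
  rewrite natrM natrX sqrtrM ?exprn_ge0// sqrtr_sqr normr_nat; congr (_ * Num.sqrt _).
  by rewrite natr_absz gtr0_norm// intrD intrM -natrD -natrX.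
pose e i := root i - (X%:R + (x i)%:R + 2 * (sgn i)%:~R * v i / X%:R).
have sumE : \sum_(i < k) Num.sqrt (a i)%:R - (\sum_(i < k) (w i)%:Z * (X + x i)%N%:Z)%:~R =
    2 / X%:R * (\sum_(i < k) (w i)%:R * ((sgn i)%:~R * v i)) + \sum_(i < k) (w i)%:R * e i.
  rewrite rmorph_sum -sumrB mulr_sumr -big_split; apply: eq_bigr => i _ /=.
  by rewrite aE /e intrM -!pmulrn natrD; ring.
have mainE : \sum_(i < k) (w i)%:R * ((sgn i)%:~R * v i) = D%:R / X%:R ^+ k.-1 :> R.
  (* After exchanging the sums only j = k - 1 survives, where the two signs (-1)^(k-1) cancel. *)
  transitivity (\sum_(j < k) (- X%:R^-1) ^+ j *
      (\sum_(i < k) (w i)%:Z * (sgn i * node_coef k i j))%:~R : R).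
    under eq_bigr do rewrite !mulr_sumr.
    rewrite exchange_big; apply: eq_bigr => j _ /=.
    rewrite rmorph_sum mulr_sumr; apply: eq_bigr => i _ /=.
    by rewrite !intrM -pmulrn; ring.
  have km : (k.-1 < k)%N by rewrite prednK.
  rewrite (bigD1 (Ordinal km))//= [X in _ + X]big1 ?addr0 => [|j jm].
    rewrite wD// eqxx intrM rmorphXn rmorphN1 /= -pmulrn mulrA -exprMn mulrN1 opprK.
    by rewrite exprVn mulrC.
  rewrite wD// ifF ?mulr0 ?mulr0//.
  by apply: contra_neqF jm => /eqP jm; apply: val_inj.
have Xk : X%:R ^+ k = X%:R * X%:R ^+ k.-1 :> R by rewrite -exprS prednK.
have errE : `|\sum_(i < k) (w i)%:R * e i| <= (X%:R ^+ k)^-1.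
  rewrite (@le_trans _ _ (\sum_(i < k) (weight_bound k)%:R *
      (8 * (residual_bound k)%:R / X%:R ^+ k.+1)))//.
    rewrite (le_trans (ler_norm_sum _ _ _))//; apply: ler_sum => i _.
    rewrite normrM normr_nat ler_pM// ?ler_nat; first by have /andP[] := wN i.
    exact: root_approx.
  rewrite sumr_const card_ord -[leLHS]mulr_natl exprS invfM !mulrA -[leRHS]mul1r.
  rewrite ler_pM2r ?invr_gt0 ?exprn_gt0// ler_pdivrMr// mul1r -!natrM ler_nat.
  by rewrite (leq_trans _ TX)// [(_ * 8)%N]mulnC mulnA.
rewrite sumE mainE; set err := \sum_(i < k) _ in errE *.
have -> : 2 / X%:R * (D%:R / X%:R ^+ k.-1) = 2 * D%:R * (X%:R ^+ k)^-1 :> R.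
  by rewrite Xk invfM; ring.
set u := (X%:R ^+ k)^-1 in errE *.
have u0 : 0 < u by rewrite invr_gt0 exprn_gt0.
have D1 : 1 <= D%:R :> R by rewrite ler1n.
have D2 : D%:R <= (weight_bound k)%:R :> R by rewrite ler_nat.
have mu1 : u <= D%:R * u by rewrite ler_peMl// ltW.
have mu2 : D%:R * u <= (weight_bound k)%:R * u by rewrite ler_pM2r.
have [e1 e2] : - u <= err /\ err <= u by move: errE; rewrite ler_norml => /andP.
rewrite natrD natrM ger0_norm; last by lra.
by apply/andP; split; lra.
Qed.

End SumOfRoots.

(** * Conclusion for large and small n *)

Lemma approx_const_gt0 k : (0 < k)%N -> (0 < approx_const k)%N.
Proof.
move=> k0; rewrite /approx_const addn_gt0; apply/orP; left.
by rewrite muln_gt0 addn1 /= expn_gt0 !muln_gt0 !expn_gt0 !muln_gt0 k0 spacing_gt0.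
Qed.

(** For n = 1 every a_j is 1 and the sum is an integer, so n starts at 2. *)
Theorem theorem1p1 (R : realType) :
  exists C : nat -> R,
    computable_sequence C /\
    forall k : nat, (1 <= k)%N ->
      0 < C k /\
      forall n : nat, (2 <= n)%N ->
        exists a : 'I_k -> nat,
          (forall j : 'I_k, (1 <= a j <= n)%N) /\
          0 < dist_int (\sum_(j < k) Num.sqrt ((a j)%:R : R))
            <= C k * n%:R `^ (- (k%:R / 2)).
Proof.
exists (fun k => (approx_const k)%:R); split.
  exact: computable_sequence_nat recursive_approx_const.
move=> k k0; split; first by rewrite ltr0n approx_const_gt0.
move=> n n2; rewrite powR_half; set r := Num.sqrt _.
have r0 : 0 < r by rewrite sqrtr_gt0 ltr0n; lia.
have rk0 : 0 < r ^+ k by rewrite exprn_gt0.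
have N0 : (0 < weight_bound k)%N by rewrite !muln_gt0 !expn_gt0 !muln_gt0 k0 spacing_gt0.
(* The scale 2 W, with W = [weight_bound k], turns a_j <= (2 W X)^2 into a_j <= n. *)
have [|X /andP[Xn nX]] := @exists_scaled_sqrtn (2 * weight_bound k) n; first by lia.
have rX : r <= (2 * weight_bound k * X.+1)%N%:R.
  rewrite -(ger0_norm (ler0n R (_ * X.+1)%N)) -sqrtr_sqr ler_sqrt ?sqr_ge0//.
  by rewrite -natrX ler_nat ltnW.
have [thX|Xth] := leqP (threshold k) X.
  have [a [z [an /andP[lo hi]]]] := exists_almost_integer_sum R k0 thX.
  have [_ _ _ NX X4] := threshold_le thX.
  have X0 : 0 < X%:R :> R by rewrite ltr0n; lia.
  exists a; split => [j|]; first by have /andP[-> /leq_trans ->] := an j.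
  apply/andP; split.
    apply: (@dist_int_gt0 _ _ z); rewrite (lt_le_trans _ lo) ?invr_gt0 ?exprn_gt0//=.
    rewrite (le_lt_trans hi)// ltr_pdivrMr ?exprn_gt0// mul1r -natrX ltr_nat.
    by rewrite (@leq_trans (X ^ 1))// ?leq_pexp2l//; lia.
  rewrite (le_trans (dist_int_le _ z))// (le_trans hi)//.
  rewrite ler_pdivrMr ?exprn_gt0// mulrAC ler_pdivlMr//.
  have rX4 : r ^+ k <= ((4 * weight_bound k) ^ k)%N%:R * X%:R ^+ k.
    rewrite natrX -exprMn -natrM lerXn2r ?nnegrE ?(ltW r0)//.
    by rewrite (le_trans rX)// ler_nat; nia.
  apply: (@le_trans _ _ (((2 * weight_bound k + 1) * (4 * weight_bound k) ^ k)%N%:R * X%:R ^+ k)).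
    by rewrite natrM -mulrA ler_pM2l// ltr0n addn1.
  by rewrite ler_pM2r ?exprn_gt0// ler_nat leq_addr.
have rth : r ^+ k <= ((2 * weight_bound k * threshold k) ^ k)%N%:R.
  by rewrite natrX lerXn2r ?nnegrE ?(ltW r0)// (le_trans rX)// ler_nat leq_mul2l Xth orbT.
(* Below the threshold the claimed bound is at least 1, so any non-integer sum will do. *)
have rC : 1 <= (approx_const k)%:R / r ^+ k.
  by rewrite ler_pdivlMr// mul1r (le_trans rth)// ler_nat leq_addl.
case: k k0 {rk0 N0 Xn nX rX Xth rth} rC => // m _ rC.
(* The sum sqrt 2 + 1 + ... + 1 lies at sqrt 2 - 1 from the integer m + 1. *)
exists (fun j => if j == ord0 then 2%N else 1%N); split => [j|].
  by case: ifP => _; rewrite ?n2//; lia.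
have s1 : 1 < Num.sqrt 2 :> R by rewrite -[ltLHS]sqrtr1 ltr_sqrt// ltr1n.
have s2 : Num.sqrt 2 < 2 :> R.
  by rewrite -[ltRHS]ger0_norm// -sqrtr_sqr ltr_sqrt// -natrX ltr_nat.
have yE : \sum_(j < m.+1) Num.sqrt (if j == ord0 then 2%N else 1%N)%:R - m.+1%:Z%:~R =
    Num.sqrt 2 - 1 :> R.
  rewrite big_ord_recl/=; under eq_bigr do rewrite sqrtr1.
  by rewrite sumr_const card_ord -pmulrn -natr1; ring.
have yn : `|Num.sqrt 2 - 1 : R| = Num.sqrt 2 - 1 by rewrite ger0_norm//; lra.
apply/andP; split.
  by apply: (@dist_int_gt0 _ _ m.+1%:Z); rewrite yE yn; apply/andP; split; lra.
rewrite (le_trans (dist_int_le _ m.+1%:Z))// yE yn (le_trans _ rC)//; lra.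
Qed.
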